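(* Let $M,N\ge 1$, let $k_1,\dots,k_M>0$ be wave numbers, let $x_1,\dots,x_N$ be the imaging pixels with total path lengths $L_1,\dots,L_N$, and let $A=(e^{-jk_iL_n})_{1\le i\le M,\,1\le n\le N}$ be the sensing matrix. Assume that a single point target is located at an arbitrary pixel $x_p$, $1\le p\le N$, of the imaging area, i.e. the exact solution $X^o$ is the $p$-th standard unit vector of $\mathbb{C}^N$. Let $b=AX^o$ and $\tilde X=A^*b$. Then the reconstructed value $\tilde X_p$ of the point target has magnitude $M$ and phase $0$.
   Context: Setting: a noiseless linear imaging system $AX=b$ with a single transmitter $T_x$, a single receiver $R_x$, and $M$ frequencies with wave numbers $k_1,\dots,k_M>0$. The imaging area has $N$ pixels located at points $x_1,\dots,x_N$ of Euclidean space, and $L_n=|T_x-x_n|+|x_n-R_x|$ is the total path length from the transmitter to $x_n$ and then to the receiver. Here $j$ is the imaginary unit. The sensing matrix $A$ is the $M\times N$ complex matrix with $(i,n)$ entry $e^{-jk_iL_n}$, and $A^*$ is its conjugate transpose. The data are generated synthetically (''inverse crime'') by $b=AX^o$, where $X^o\in\mathbb{C}^N$ is the exact reflectivity vector, and the reconstructed solution is $\tilde X=A^*b$. The reconstructed value of a point target at pixel $x_p$ is the $p$-th entry $\tilde X_p$. Magnitude and phase of a nonzero complex number $z=Ce^{j\theta}$ are $C=|z|>0$ and $\theta$, the phase being considered modulo $2\pi$. *)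

(* Defs.v *)
From HB Require Import structures.
From mathcomp Require Import all_boot all_order all_algebra.
From mathcomp Require Import all_classical all_reals.
From mathcomp Require Import topology normedtype sequences exp trigo.
From mathcomp Require Export complex.

Set Implicit Arguments.
Unset Strict Implicit.
Unset Printing Implicit Defensive.

Import Order.TTheory GRing.Theory Num.Theory.

Local Open Scope classical_set_scope.
Local Open Scope complex_scope.
Local Open Scope ring_scope.

(* The norm carried by 'rV[R]_d in the library is the sup norm, hence an
   explicit Euclidean norm. *)
Definition enorm (R : realType) (d : nat) (v : 'rV[R]_d) : R :=
  Num.sqrt (\sum_(c < d) v 0 c ^+ 2).

Definition path_length (R : realType) (d N : nat) (Tx Rx : 'rV[R]_d)
    (x : 'I_N -> 'rV[R]_d) (n : 'I_N) : R :=
  enorm (Tx - x n) + enorm (x n - Rx).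

(* Complex exponential, by Euler's formula. *)
Definition cexp (R : realType) (z : R[i]) : R[i] :=
  (expR (complex.Re z))%:C *
  (cos (complex.Im z) +i* sin (complex.Im z)).

(* 'i%C is 0 +i* 1; without the scope delimiter, 'i would parse as
   Num.imaginary. *)
Definition sensing_mx (R : realType) (M N : nat) (k : 'I_M -> R)
    (L : 'I_N -> R) : 'M[R[i]]_(M, N) :=
  \matrix_(i < M, n < N) cexp (- ('i%C * (k i)%:C * (L n)%:C)).

(* Being defined modulo 2 pi, the phase of a nonzero complex number is encoded
   as a coset of 2 pi Z in R, i.e. as the set of all its real representatives
   (this set is empty for z = 0). *)
Definition phase (R : realType) (z : R[i]) : set R :=
  [set theta | exists2 C : R, 0 < C & z = C%:C * cexp ('i%C * theta%:C)].

Definition mod2pi (R : realType) (theta : R) : set R :=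
  [set theta + m%:~R * (2 * pi) | m in [set: int]].

(* Main.v *)
Require Import Defs.
From mathcomp Require Import all_boot all_order all_algebra.
From mathcomp Require Import all_classical all_reals.
From mathcomp Require Import exp trigo.
From mathcomp Require Import ring lra.

Import Order.TTheory GRing.Theory Num.Theory.

Local Open Scope complex_scope.
Local Open Scope sesquilinear_scope.
Local Open Scope ring_scope.

(** Since [Xo] is a unit vector, [Xt p 0] is the [p]-th diagonal entry of [A ^t* *m A], that is, the
    squared Euclidean norm of column [p] of [A]. Each of the M entries in that column lies on the
    unit circle and contributes 1 ([mulJ_cexp_i]), whatever the path length, so the value is exactly
    M. The magnitude is then immediate. As phases are cosets, phase 0 means that the arguments of a
    positive real are precisely the multiples of 2 pi ([phase_pos]), which rests on [cos_eq1]. *)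

Lemma cos_sinD2piz (R : realType) (t : R) (m : int) :
  cos (t + m%:~R * (2 * pi)) = cos t /\ sin (t + m%:~R * (2 * pi)) = sin t.
Proof.
have E (u : R) (n : nat) : cos (u + n%:R * (2 * pi)) = cos u /\
    sin (u + n%:R * (2 * pi)) = sin u.
  have -> : n%:R * (2 * pi) = pi *+ 2 *+ n :> R.
    by rewrite mulr_natl mulr_natl.
  by rewrite (periodicn (@cosD2pi R)) (periodicn (@sinD2pi R)).
case: m => n; first exact: E.
(* For a negative shift, start from the shifted point: [n.+1] forward periods lead back to [t]. *)
have [<- <-] := E (t + (Negz n)%:~R * (2 * pi)) n.+1.
by rewrite NegzE mulrNz mulNr subrK.
Qed.

Lemma cos_eq1 (R : realType) (t : R) :
  cos t = 1 <-> exists m : int, t = m%:~R * (2 * pi).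
Proof.
split=> [cost|[m ->]]; last first.
  by have [+ _] := cos_sinD2piz R 0 m; rewrite add0r cos0.
have twopi_gt0 : 0 < 2 * pi :> R by rewrite mulr_gt0 ?pi_gt0.
pose m := Num.floor (t / (2 * pi)).
exists m.
(* [cos t = 1 - 2 sin^2 (t / 2)], and [sin] has no zero in ]0, pi[: reduce the
   half-angle modulo pi. *)
pose y : R := t / 2 - m%:~R * pi.
have tE : t = m%:~R * (2 * pi) + y *+ 2 by rewrite /y; field.
have y_ge0 : 0 <= y.
  have := floor_le (t / (2 * pi)); rewrite -/m ler_pdivlMr // => h.
  by rewrite /y; lra.
have y_ltpi : y < pi.
  have := floorD1_gt (t / (2 * pi)); rewrite -/m intrD ltr_pdivrMr // => h.
  by rewrite /y; lra.
have siny : sin y = 0.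
  have [cosE _] := cos_sinD2piz R (y *+ 2) m.
  move: cost; rewrite tE addrC cosE cos_mulr2n cos2sin2 => h.
  by apply/eqP; rewrite -sqrf_eq0; apply/eqP; lra.
suff y0 : y = 0 by rewrite tE y0 mul0rn addr0.
apply/eqP; rewrite eq_le y_ge0 andbT leNgt; apply/negP => y_gt0.
by have := @sin_gt0_pi R y; rewrite siny ltxx y_gt0 y_ltpi => /(_ isT).
Qed.

Lemma cexp_i (R : realType) (t : R) :
  cexp ('i%C * t%:C) = cos t +i* sin t.
Proof.
by rewrite /cexp /= !mul0r !mul1r subr0 add0r expR0 mul1r.
Qed.

Lemma mulJ_cexp_i (R : realType) (t : R) :
  (cexp ('i%C * t%:C))^* * cexp ('i%C * t%:C) = 1.
Proof.
rewrite cexp_i; apply/eqP; rewrite eq_complex /=; apply/andP; split; apply/eqP.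
  by rewrite -(cos2Dsin2 t); ring.
by ring.
Qed.

(** Comparing real and imaginary parts in r = C e^(it) with C > 0 gives sin t = 0 and cos t > 0,
    hence cos t = 1. Conversely, C = r serves every multiple of 2 pi. *)
Lemma phase_pos (R : realType) (r : R) : 0 < r -> phase r%:C = mod2pi (0 : R).
Proof.
move=> r_gt0; apply/seteqP; split => t /=.
  case=> C C_gt0; rewrite cexp_i => /eqP; rewrite eq_complex /=.
  rewrite !mul0r subr0 addr0 => /andP[/eqP rE /eqP/esym/eqP].
  rewrite mulf_eq0 gt_eqF //= => /eqP sint.
  have cost : 0 < cos t by rewrite -(pmulr_rgt0 _ C_gt0) -rE.
  have := sin0cos1 sint; rewrite gtr0_norm // => /cos_eq1[m ->].
  by exists m; rewrite ?add0r.
case=> m _ <-; exists r => //.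
have [cosE sinE] := cos_sinD2piz R 0 m.
by rewrite cexp_i cosE sinE cos0 sin0 mulr1.
Qed.

Theorem theorem1 (R : realType) (d M N : nat) (hM : (1 <= M)%N) (hN : (1 <= N)%N)
    (k : 'I_M -> R) (hk : forall i, 0 < k i)
    (Tx Rx : 'rV[R]_d) (x : 'I_N -> 'rV[R]_d)
    (L : 'I_N -> R) (hL : forall n, L n = path_length Tx Rx x n)
    (A : 'M[R[i]]_(M, N)) (hA : A = sensing_mx k L)
    (p : 'I_N)
    (Xo : 'cV[R[i]]_N) (hXo : Xo = delta_mx p 0)
    (b : 'cV[R[i]]_M) (hb : b = A *m Xo)
    (Xt : 'cV[R[i]]_N) (hXt : Xt = A ^t* *m b) :
  `|Xt p 0| = M%:R /\ phase (Xt p 0) = mod2pi 0.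
Proof.
have XtE : Xt p 0 = M%:R.
  (* [A *m delta_mx p 0] is column [p]; writing M as a sum of ones over ['I_M] allows a termwise
     comparison. *)
  rewrite hXt hb hXo -colE mxE -[M in RHS]card_ord -sumr_const; apply: eq_bigr => i _.
  rewrite hA !mxE.
  have -> : - ('i%C * (k i)%:C * (L p)%:C) = 'i%C * (- (k i * L p))%:C.
    by rewrite rmorphN rmorphM /= mulrN mulrA.
  exact: mulJ_cexp_i.
rewrite XtE normr_nat; split=> //.
(* [hM] makes this real number positive, as [phase_pos] requires. *)
by rewrite -(rmorph_nat (@real_complex R)) phase_pos // ltr0n.
Qed.
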